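(* Assume $\bigcup_{y\in\mathcal L}\mathcal L^y=\mathcal L$. Under the cost model given in the context, the total computational cost $\operatorname{cost}=\operatorname{cost}_1+\dots+\operatorname{cost}_6$ of the hierarchical reinforced regression algorithm B with $M$ sample trajectories, $J$ time steps, $K$ standard basis functions and $I\ge 1$ reinforcement levels satisfies $$\operatorname{cost}\le \mathrm{const}\cdot MJ\left(c_X+I^2\,(K+|\mathcal K|+|\mathcal L|)\,|\mathcal L|+(K+R)^2\,|\mathcal L|\right),$$ where $\mathrm{const}$ is a positive number independent of $|\mathcal K|$, $|\mathcal L|$, $K$, $J$ and $I$ (the difference between the constants $c_f$ and $c_\ast$ being ignored, both being absorbed in $\mathrm{const}$).
   Context: Problem. $X=(X_j)_{0\le j\le J}$ is a Markov chain in $\mathbb R^d$; $\mathcal K$ (actions) and $\mathcal L$ (controls) are finite sets; $K_j(y,x)\subset\mathcal K$ is the set of admissible actions at time $j$ for $y\in\mathcal L$, $x\in\mathbb R^d$; $H_j(a,y,x)$ is the cash-flow; $\varphi_{j+1}:\mathcal K\times\mathcal L\to\mathcal L$ is the control update. Algorithm B. Given are $M$ sample trajectories $(X^{(m)}_j)_{0\le j\le J}$, $1\le m\le M$, of $X$, basis functions $\psi_1,\dots,\psi_K:\mathbb R^d\to\mathbb R$, an integer $I$ with $1\le I\le J$, and for each $y\in\mathcal L$ a subset $\mathcal L^y=\{y_1,\dots,y_{R^y}\}\subset\mathcal L$ of cardinality $R^y$; $R:=\max_{y}R^y$. Initialize $v^{(i)}_J(y,x)=\max_{a\in K_J(y,x)}H_J(a,y,x)$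 for $0\le i\le I$. For $j=J-1,\dots,0$: for $i=0$ and each $y\in\mathcal L$ solve the least squares problem $$(\gamma^{(0),y}_{j,k})_{k\le K}\in\arg\min_{\gamma}\sum_{m=1}^M\Bigl|v^{(I)}_{j+1}(y,X^{(m)}_{j+1})-\sum_{k=1}^K\gamma_k\psi_k(X^{(m)}_j)\Bigr|^2\qquad (\mathrm{LS}_0)$$ and set $c^{(0)}_j(y,x)=\sum_{k}\gamma^{(0),y}_{j,k}\psi_k(x)$; for $1\le i\le I$ and each $y\in\mathcal L$ solve $$(\gamma^{(i),y}_{j,k})_{k\le K+R^y}\in\arg\min_{\gamma}\sum_{m=1}^M\Bigl|v^{(I)}_{j+1}(y,X^{(m)}_{j+1})-\sum_{k=1}^K\gamma_k\psi_k(X^{(m)}_j)-\sum_{k=1}^{R^y}\gamma_{K+k}v^{(i-1)}_{j+1}(y_k,X^{(m)}_j)\Bigr|^2\qquad (\mathrm{LS}_i)$$ and set $c^{(i)}_j(y,x)=\sum_{k=1}^K\gamma^{(i),y}_{j,k}\psi_k(x)+\sum_{k=1}^{R^y}\gamma^{(i),y}_{j,K+k}v^{(i-1)}_{j+1}(y_k,x)$. Finally $v^{(i)}_j(y,x)=\max_{a\in K_j(y,x)}\bigl(H_j(a,y,x)+c^{(i)}_j(\varphi_{j+1}(a,y),x)\bigr)$ for $0\le i\le I$. Cost model. Primitive operations cost $c_\ast$, simulation from the distribution of $X_j$ costs $c_X$, and evaluation of a basis function $\psi_k$ or of $H_j$ costs $c_f$. If an expression involves several such operations only the most expensive constant is reported.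 Write $\mathbf v^{(i)}_j=(v^{(i)}_j(y,\cdot))_{y\in\mathcal L}$ and let $\operatorname{cost}(\mathbf v^{(i)}_j)$ be the cost of evaluating the whole vector at a point once the regression coefficients are known. These evaluation costs satisfy: $\operatorname{cost}(\mathbf v^{(i)}_J)\le|\mathcal L||\mathcal K|(c_f+c_\ast)$ and, for $j<J$, $$\operatorname{cost}(\mathbf v^{(i)}_j)\le|\mathcal K||\mathcal L|(c_f+c_\ast)+Kc_f+K|\mathcal L|c_\ast+\mathbf 1_{i>0}\bigl(|\mathcal L|^2c_\ast+\operatorname{cost}(\mathbf v^{(i-1)}_{j+1})\bigr).$$ The stages of the algorithm are charged as follows: - simulating trajectories: $\operatorname{cost}_1=c_XM(J+1)$; - computing the terminal value function: $\operatorname{cost}_2=c_f|\mathcal L||\mathcal K|$; - setting up all problems $(\mathrm{LS}_0)$: $\operatorname{cost}_3\le\sum_{j=0}^{J-1}M\bigl(Kc_f+\operatorname{cost}(\mathbf v^{(I)}_{j+1})\bigr)$; - solving all problems $(\mathrm{LS}_0)$: $\operatorname{cost}_4=c_\ast JMK^2|\mathcal L|$; - setting up all problems $(\mathrm{LS}_i)$, $1\le i\le I$ (where $\mathbf v^{(I)}_{j+1}$ has already been evaluated): $\operatorname{cost}_5\le\sum_{j=0}^{J-1}M\bigl(Kc_f+\sum_{i=1}^I\operatorname{cost}(\mathbf v^{(i-1)}_{j+1})\bigr)$; - solving the problems $(\mathrm{LS}_i)$: total charged cost $\operatorname{cost}_6=c_\ast M(K+R)^2J|\mathcal L|$. *)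

(* Defs.v *)
From HB Require Import structures.
From mathcomp Require Import all_boot all_order all_algebra.
From mathcomp Require Import all_classical all_reals all_analysis.

Set Implicit Arguments.
Unset Strict Implicit.
Unset Printing Implicit Defensive.

Import Order.TTheory GRing.Theory Num.Theory.
Import numFieldNormedType.Exports.
Local Open Scope classical_set_scope.
Local Open Scope ring_scope.

(* R^d with the product of the Borel sigma-algebras of the coordinates. *)
Definition state (R : realType) (d : nat) : measurableType _ := d.-tuple R.

(* Markov property with respect to the natural filtration, through one-step
   transition kernels: P(X_{j+1} in C | X_0, ..., X_j) = kappa_j(X_j, C), tested
   on the events {X_0 in B_0, ..., X_j in B_j}, which generate the sigma-algebra
   of X_0, ..., X_j.  Only the times 0, ..., J matter. *)
Record is_markov_chain (R : realType) (d J : nat) (dO : measure_display)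
    (Omega : measurableType dO) (P : probability Omega R)
    (X : nat -> Omega -> state R d) : Prop := IsMarkovChain {
  markov_measurable : forall j, (j <= J)%N -> measurable_fun setT (X j) ;
  markov_transition : forall j, (j < J)%N ->
    exists kappa : R.-pker (state R d) ~> (state R d),
    forall (B : nat -> set (state R d)) (C : set (state R d)),
      (forall i, measurable (B i)) -> measurable C ->
      let past := \bigcap_(i in [set i | (i <= j)%N]) (X i @^-1` B i) in
      P (past `&` X j.+1 @^-1` C) = (\int[P]_(w in past) kappa (X j w) C)%E }.

Record control_problem (R : realType) (d : nat) (Act Ctl : finType) :=
  ControlProblem {
    admissible : nat -> Ctl -> state R d -> {set Act} ;
    cash_flow : nat -> Act -> Ctl -> state R d -> R ;
    update : nat -> Act -> Ctl -> Ctl }.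

(* w is the maximum of f over A; in particular A is nonempty. *)
Definition is_max_over (R : realType) (T : finType) (A : {set T}) (f : T -> R)
    (w : R) : Prop :=
  (exists2 a, a \in A & w = f a) /\ forall a, a \in A -> f a <= w.

(* g minimises sum_m | z_m - sum_k g_k b_k(m) |^2. *)
Definition least_squares (R : realType) (M n : nat) (z : 'I_M -> R)
    (b : 'I_n -> 'I_M -> R) (g : 'rV[R]_n) : Prop :=
  forall h : 'rV[R]_n,
    \sum_(m < M) `|z m - \sum_(k < n) g 0 k * b k m| ^+ 2 <=
    \sum_(m < M) `|z m - \sum_(k < n) h 0 k * b k m| ^+ 2.

(* The K + R^y regressors of the reinforced problem: psi_1, ..., psi_K followed
   by u(y_1, .), ..., u(y_{R^y}, .), where y_1, ..., y_{R^y} is the standard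
   enumeration of Ly. *)
Definition reinforced_basis (R : realType) (d K : nat) (Ctl : finType)
    (psi : 'I_K -> state R d -> R) (Ly : {set Ctl})
    (u : Ctl -> state R d -> R) (k : 'I_(K + #|Ly|)) (x : state R d) : R :=
  match fintype.split k with
  | inl k1 => psi k1 x
  | inr k2 => u (enum_val k2) x
  end.

(* A run of the algorithm on the trajectories Xs m = (Xs m j)_{0 <= j <= J}:
   any choice of least squares solutions, with the resulting functions.  The
   upper index i comes first: value i j y x = v^(i)_j(y, x) and
   cont i j y x = c^(i)_j(y, x), for i <= I and j <= J.  The coefficients of
   level i + 1 are reg_coef i.+1; those of level 0 are reg_coef0. *)
Record algB_run (R : realType) (d : nat) (Act Ctl : finType)
    (pb : control_problem R d Act Ctl) (J I M K : nat)
    (psi : 'I_K -> state R d -> R) (L_ : Ctl -> {set Ctl})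
    (Xs : 'I_M -> nat -> state R d) := AlgBRun {
  reg_coef0 : nat -> Ctl -> 'rV[R]_K ;
  reg_coef : nat -> nat -> forall y : Ctl, 'rV[R]_(K + #|L_ y|) ;
  cont : nat -> nat -> Ctl -> state R d -> R ;
  value : nat -> nat -> Ctl -> state R d -> R ;
  run_terminal : forall i y x, (i <= I)%N ->
    is_max_over (admissible pb J y x) (fun a => cash_flow pb J a y x)
      (value i J y x) ;
  run_LS0 : forall j y, (j < J)%N ->
    least_squares (fun m => value I j.+1 y (Xs m j.+1))
      (fun k m => psi k (Xs m j)) (reg_coef0 j y) ;
  run_cont0 : forall j y x, (j < J)%N ->
    cont 0 j y x = \sum_(k < K) reg_coef0 j y 0 k * psi k x ;
  run_LS : forall i j y, (i < I)%N -> (j < J)%N ->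
    least_squares (fun m => value I j.+1 y (Xs m j.+1))
      (fun k m => reinforced_basis psi (value i j.+1) k (Xs m j))
      (reg_coef i.+1 j y) ;
  run_cont : forall i j y x, (i < I)%N -> (j < J)%N ->
    cont i.+1 j y x =
      \sum_(k < K + #|L_ y|)
        reg_coef i.+1 j y 0 k * reinforced_basis psi (value i j.+1) k x ;
  run_value : forall i j y x, (i <= I)%N -> (j < J)%N ->
    is_max_over (admissible pb j y x)
      (fun a => cash_flow pb j a y x + cont i j (update pb j.+1 a y) x)
      (value i j y x) }.

(* Costs charged to a run.  eval_cost i j is the cost of evaluating the whole
   vector (v^(i)_j(y, .))_y at one point; nA, nL and Rmax stand for the number
   of actions, the number of controls and max_y R^y. *)
Record cost_model (R : realType) (c_star c_X c_f : R) (J I M K nA nL Rmax : nat)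
    := CostModel {
  eval_cost : nat -> nat -> R ;
  cost1 : R ;
  cost2 : R ;
  cost3 : R ;
  cost4 : R ;
  cost5 : R ;
  cost6 : R ;
  eval_cost_terminal : forall i, (i <= I)%N ->
    eval_cost i J <= nL%:R * nA%:R * (c_f + c_star) ;
  eval_cost_step0 : forall j, (j < J)%N ->
    eval_cost 0 j <=
      nA%:R * nL%:R * (c_f + c_star) + K%:R * c_f + K%:R * nL%:R * c_star ;
  eval_cost_stepS : forall i j, (i < I)%N -> (j < J)%N ->
    eval_cost i.+1 j <=
      nA%:R * nL%:R * (c_f + c_star) + K%:R * c_f + K%:R * nL%:R * c_star
      + (nL%:R ^+ 2 * c_star + eval_cost i j.+1) ;
  cost1E : cost1 = c_X * M%:R * (J + 1)%:R ;
  cost2E : cost2 = c_f * nL%:R * nA%:R ;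
  cost3_le :
    cost3 <= \sum_(0 <= j < J) M%:R * (K%:R * c_f + eval_cost I j.+1) ;
  cost4E : cost4 = c_star * J%:R * M%:R * K%:R ^+ 2 * nL%:R ;
  cost5_le :
    cost5 <= \sum_(0 <= j < J)
      M%:R * (K%:R * c_f + \sum_(1 <= i < I.+1) eval_cost i.-1 j.+1) ;
  cost6E : cost6 = c_star * M%:R * (K + Rmax)%:R ^+ 2 * J%:R * nL%:R }.

Definition total_cost (R : realType) (c_star c_X c_f : R)
    (J I M K nA nL Rmax : nat)
    (C : cost_model c_star c_X c_f J I M K nA nL Rmax) : R :=
  cost1 C + cost2 C + cost3 C + cost4 C + cost5 C + cost6 C.

(* Main.v *)
(** Every level of the recursion for the evaluation costs adds at most
    [c T], where [c = c_f + c_star] and [T = (K + |Act| + |Ctl|) |Ctl|]: the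
    term [K c_f] is absorbed because [|Ctl| >= 1].  The recursion descends at
    most [i] times, so [cost(v^(i)_j) <= (i + 1) c T], and summing over the [I]
    levels gives the factor [I^2]. *)
Require Import Defs.
From HB Require Import structures.
From mathcomp Require Import all_boot all_order all_algebra.
From mathcomp Require Import all_classical all_reals all_analysis.
From mathcomp Require Import ring lra.

Set Implicit Arguments.
Unset Strict Implicit.
Unset Printing Implicit Defensive.

Import Order.TTheory GRing.Theory Num.Theory.
Import numFieldNormedType.Exports.
Local Open Scope ring_scope.

Section CostBounds.
Variables (R : realType) (c_star c_X c_f : R).
Hypotheses (c_star_ge0 : 0 <= c_star) (c_f_ge0 : 0 <= c_f).
Variables (J I M K nA nL Rmax : nat).
Hypothesis nL_gt0 : (0 < nL)%N.
Variable C : cost_model c_star c_X c_f J I M K nA nL Rmax.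

Let c := c_f + c_star.
Let T : R := (K + nA + nL)%:R * nL%:R.

Let nL_ge1 : 1 <= nL%:R :> R.
Proof. by rewrite ler1n. Qed.

(** Absorbs the term [K c_f] that [cost3] and [cost5] charge next to the evaluation costs. *)
Lemma basis_cost_le : K%:R * c_f <= c * T.
Proof.
have KT : K%:R <= T.
  apply: (@le_trans _ _ (K + nA + nL)%:R); last by rewrite ler_peMr.
  by rewrite ler_nat -addnA leq_addr.
by rewrite mulrC; apply: ler_pM; rewrite ?lerDl.
Qed.

(** Expanding [c * T] reproduces the left side term by term, once [K c_f] is enlarged to [K nL c_f];
    the leftover [nL^2 c_f] is nonnegative. *)
Lemma level_cost_le :
  nA%:R * nL%:R * (c_f + c_star) + K%:R * c_f + K%:R * nL%:R * c_star
    + nL%:R ^+ 2 * c_star <= c * T.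
Proof.
have KL : K%:R * c_f <= K%:R * nL%:R * c_f.
  by rewrite ler_wpM2r // ler_peMr.
have LL : 0 <= nL%:R ^+ 2 * c_f by rewrite mulr_ge0 // exprn_ge0.
have -> : c * T = nA%:R * nL%:R * (c_f + c_star) + K%:R * nL%:R * c_f
    + K%:R * nL%:R * c_star + nL%:R ^+ 2 * c_star + nL%:R ^+ 2 * c_f.
  by rewrite /c /T !natrD; ring.
lra.
Qed.

Lemma eval_cost_le i j : (i <= I)%N -> (j <= J)%N ->
  eval_cost C i j <= i.+1%:R * (c * T).
Proof.
have lvl := level_cost_le.
have LL : 0 <= nL%:R ^+ 2 * c_star by rewrite mulr_ge0 // exprn_ge0.
have KF : 0 <= K%:R * c_f by rewrite mulr_ge0.
have KL : 0 <= K%:R * nL%:R * c_star by rewrite !mulr_ge0.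
have cT0 : 0 <= c * T by rewrite !mulr_ge0 ?addr_ge0.
(* [j] stays general because one unfolding lowers [i] and raises [j]; the recursion stops at level
   [0] or at time [J]. *)
elim: i j => [|i IHi] j leI; rewrite leq_eqVlt => /predU1P[-> | ltJ].
- have := eval_cost_terminal C leI; lra.
- have := eval_cost_step0 C ltJ; lra.
- have : c * T <= i.+2%:R * (c * T) by rewrite ler_peMl // ler1n.
  have := eval_cost_terminal C leI; lra.
have := eval_cost_stepS C leI ltJ; have := IHi j.+1 (ltnW leI) ltJ.
rewrite -[i.+2%:R]natr1 (mulrDl _ 1) mul1r; lra.
Qed.

(** With [U = I^2 T], the stages 2, 3 and 5 use 1, 3 and 2 copies of [c U], hence [6 c]; the summand
    2 pays for [cost1]. The two copies of [c S] from stages 4 and 6 fit in [6 c S]. *)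
Lemma total_cost_le : 0 <= c_X -> (0 < M)%N -> (0 < I <= J)%N ->
  total_cost C <= (6 * c + 2) * (M * J)%:R *
    (c_X + I%:R ^+ 2 * (K + nA + nL)%:R * nL%:R
         + (K + Rmax)%:R ^+ 2 * nL%:R).
Proof.
move=> c_X0 M_gt0 /andP[I_gt0 leIJ].
set S : R := (K + Rmax)%:R ^+ 2 * nL%:R.
rewrite -[I%:R ^+ 2 * _ * _]mulrA -/T.
have J_gt0 : (0 < J)%N := leq_trans I_gt0 leIJ.
have c0 : 0 <= c by rewrite addr_ge0.
have T0 : 0 <= T by rewrite mulr_ge0.
have S0 : 0 <= S by rewrite mulr_ge0 // exprn_ge0.
have cT0 : 0 <= c * T by rewrite mulr_ge0.
have I1 : 1 <= I%:R :> R by rewrite ler1n.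
have M1 : 1 <= M%:R :> R by rewrite ler1n.
have J1 : 1 <= J%:R :> R by rewrite ler1n.
have MJ1 : 1 <= (M * J)%:R :> R by rewrite ler1n muln_gt0 M_gt0.
have I2 : I%:R <= I%:R ^+ 2 :> R by rewrite expr2 ler_peMr.
set U : R := I%:R ^+ 2 * T.
have U0 : 0 <= U by rewrite mulr_ge0 ?exprn_ge0.
have cTU : c * T <= c * U.
  by rewrite ler_wpM2l // ler_peMl // (le_trans I1).
have IcTU : I%:R * (c * T) <= c * U.
  by rewrite mulrCA ler_wpM2l // ler_wpM2r.
have sum_le (F : nat -> R) b : (forall j, (j < J)%N -> F j <= b) ->
    \sum_(0 <= j < J) M%:R * F j <= (M * J)%:R * b.
  move=> Fb; rewrite natrM -mulr_sumr -mulrA ler_wpM2l // big_mkord.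
  have F_le (i : 'I_J) : true -> F i <= b by move=> _; exact: Fb.
  apply: (le_trans (ler_sum _ F_le)).
  by rewrite sumr_const card_ord mulr_natl.
(* The factor 2 comes from [J + 1 <= 2 J]. *)
have le1 : cost1 C <= (M * J)%:R * (2 * c_X).
  have -> : (M * J)%:R * (2 * c_X) = c_X * M%:R * (J%:R + J%:R).
    by rewrite natrM; ring.
  by rewrite cost1E natrD ler_wpM2l ?mulr_ge0 ?lerD2l.
have le2 : cost2 C <= (M * J)%:R * (c * U).
  have : cost2 C <= c * T.
    rewrite cost2E /c /T -mulrA; apply: ler_pM; rewrite ?mulr_ge0 ?lerDl //.
    by rewrite mulrC ler_wpM2r // ler_nat -addnA addnCA leq_addr.
  move=> /le_trans; apply; apply: (le_trans cTU).
  by rewrite ler_peMl // mulr_ge0.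
(* One [c U] for the basis functions, and two for [(I + 1) c T = I c T + c T]. *)
have le3 : cost3 C <= (M * J)%:R * (3 * (c * U)).
  apply: (le_trans (cost3_le C)); apply: sum_le => j ltJ.
  have := basis_cost_le; have := eval_cost_le (leqnn I) ltJ.
  rewrite -[I.+1%:R]natr1 (mulrDl _ 1) mul1r; lra.
have le4 : cost4 C <= (M * J)%:R * (c * S).
  have -> : cost4 C = (M * J)%:R * (c_star * (K%:R ^+ 2 * nL%:R)).
    by rewrite cost4E natrM; ring.
  rewrite ler_wpM2l //; apply: ler_pM; rewrite ?mulr_ge0 ?exprn_ge0 ?lerDr //.
  by rewrite ler_wpM2r // lerXn2r ?nnegrE // ler_nat leq_addr.
have le5 : cost5 C <= (M * J)%:R * (2 * (c * U)).
  apply: (le_trans (cost5_le C)); apply: sum_le => j ltJ.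
  (* After the index shift only levels [i < I] occur, each costing at most [(i + 1) c T <= I c T];
     the [I] terms give exactly [I^2 c T]. *)
  have : \sum_(1 <= i < I.+1) eval_cost C i.-1 j.+1 <= c * U.
    rewrite big_add1 big_mkord /=.
    have le_i (i : 'I_I) : true -> eval_cost C i j.+1 <= I%:R * (c * T).
      move=> _; apply: (le_trans (eval_cost_le (ltnW (ltn_ord i)) ltJ)).
      by rewrite ler_wpM2r // ler_nat.
    apply: (le_trans (ler_sum _ le_i)).
    rewrite sumr_const card_ord -[leLHS]mulr_natl.
    by have -> : I%:R * (I%:R * (c * T)) = c * U by rewrite /U; ring.
  have := basis_cost_le; lra.
have le6 : cost6 C <= (M * J)%:R * (c * S).
  have -> : cost6 C = (M * J)%:R * (c_star * S) by rewrite cost6E /S natrM; ring.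
  by rewrite ler_wpM2l // ler_wpM2r // lerDr.
(* The exact gap between the target and the sum of the six bounds. *)
have slack : 0 <= (M * J)%:R * (6 * (c * c_X) + 2 * U + 4 * (c * S) + 2 * S).
  by rewrite mulr_ge0 // !addr_ge0 ?mulr_ge0.
have -> : (6 * c + 2) * (M * J)%:R * (c_X + U + S) =
    (M * J)%:R * (2 * c_X) + (M * J)%:R * (c * U)
    + (M * J)%:R * (3 * (c * U)) + (M * J)%:R * (c * S)
    + (M * J)%:R * (2 * (c * U)) + (M * J)%:R * (c * S)
    + (M * J)%:R * (6 * (c * c_X) + 2 * U + 4 * (c * S) + 2 * S).
  by ring.
rewrite /total_cost; lra.
Qed.

End CostBounds.

Theorem theorem5p5 (R : realType) (c_star c_f : R)
    (c_star_ge0 : 0 <= c_star) (c_f_ge0 : 0 <= c_f) :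
  exists2 const : R, 0 < const &
  forall (c_X : R) (d J I M K : nat) (Act Ctl : finType)
    (dO : measure_display) (Omega : measurableType dO) (P : probability Omega R)
    (X : nat -> Omega -> state R d) (omega : 'I_M -> Omega)
    (pb : control_problem R d Act Ctl) (psi : 'I_K -> state R d -> R)
    (L_ : Ctl -> {set Ctl}),
  0 <= c_X -> (0 < M)%N -> (1 <= I <= J)%N -> (0 < #|Ctl|)%N ->
  is_markov_chain J P X ->
  (\bigcup_(y : Ctl) L_ y)%SET = [set: Ctl]%SET ->
  forall (run : algB_run pb J I psi L_ (fun m j => X j (omega m)))
    (C : cost_model c_star c_X c_f J I M K #|Act| #|Ctl|
           (\max_(y : Ctl) #|L_ y|)),
  total_cost C <=
    const * (M * J)%:R *
    (c_X + I%:R ^+ 2 * (K + #|Act| + #|Ctl|)%:R * #|Ctl|%:R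
         + (K + \max_(y : Ctl) #|L_ y|)%:R ^+ 2 * #|Ctl|%:R).
Proof.
(* The summand 2 also keeps the constant positive when [c_f = c_star = 0]. *)
exists (6 * (c_f + c_star) + 2).
  by rewrite ltr_wpDl // mulr_ge0 // addr_ge0.
move=> c_X d J I M K Act Ctl dO Omega P X omega pb psi L_.
move=> c_X0 M_gt0 I_J Ctl_gt0 _ _ _ C.
exact: total_cost_le.
Qed.
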